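(* Let $H={\rm SL}_q(N)$ with CQT structure $\sigma$ and take $X=A=H$ in the construction of the context, so that $\underline{{\rm SL}_q(N)}$ is a braided Hopf algebra in the category of left Yetter–Drinfeld modules over $U_q^{\rm ext}({\rm sl}_N)^{\rm cop}=H_\sigma^{\rm cop}$, with structure $x\circ y=\sigma(S(x_3)S^2(x_1),y_2)x_2y_1$, $\underline\Delta(x)=\sigma(S(x_1)x_3,S(x_4)x_6)x_2\otimes x_5$, $\underline S(x)=\sigma(S^2(x_3)S(x_1),x_4)S(x_2)$. Then its unit and counit are those of ${\rm SL}_q(N)$, and on generators (all sums over indices in $\{1,\dots,N\}$ subject to the stated constraints, $[a>b]$ the indicator of $a>b$): $$x_{im}\circ x_{jn}=q^{\delta_{i,n}-\delta_{m,n}}x_{im}x_{jn}+(q-q^{-1})\delta_{i,n}\sum_{s>n}q^{2(s-i)-\delta_{s,m}}x_{sm}x_{js}-[m>n]q^{\delta_{i,n}}(q-q^{-1})x_{in}x_{jm}-[m>n+1](q-q^{-1})^2\delta_{i,n}\sum_{n<s<m}q^{2(s-i)}x_{ss}x_{jm};$$ $$\underline\Delta(x_{im})=q^{-2N-1}\Big\{q^{-\delta_{i,m}}\sum_sq^{2s+\delta_{s,i}+\delta_{s,m}}x_{is}\otimes x_{sm}+(q-q^{-1})\Big[x_{im}\otimes x_+^{>m}-\delta_{i,m}\sum_s\sum_{t>i}q^{2(s+\delta_{s,i})}x_{ts}\otimes x_{st}+x_+^{>i}\otimes x_{im}\Big]$$ $$+(q-q^{-1})^2\Big[\sum_{s>i,\,s>m}q^{2s-1}x_{sm}\otimes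 x_{is}-[i>m]q^{2i+1}\sum_{s>i}x_{sm}\otimes x_{is}-[m>i]q^{2m+1}\sum_{s>m}x_{sm}\otimes x_{is}\Big]-(q-q^{-1})^3\sum_{t>s,\ s>i,\ s>m}q^{2s}x_{tm}\otimes x_{it}\Big\},$$ where $x_+^{>k}=\sum_{s>k}q^{2s}x_{ss}$; and $$\underline S(x_{im})=q^{2N+1}\big[q^{-2m-\delta_{i,m}}S(x_{im})-(q-q^{-1})\delta_{i,m}S(x_-^{>m})\big],\qquad x_-^{>m}=\sum_{s>m}q^{-2s}x_{ss},$$ with $S$ the antipode of ${\rm SL}_q(N)$.
   Context: $k$ a field, $q\in k$, $q\ne0$, $q^2\ne1$, $N\ge2$, $z\in k$ with $z^N=q^{-1}$. ${\rm SL}_q(N)$ is the Hopf algebra generated by $x_{ij}$ ($1\le i,j\le N$) with relations $x_{im}x_{in}=qx_{in}x_{im}$ ($n<m$), $x_{jm}x_{im}=qx_{im}x_{jm}$ ($i<j$), $x_{jn}x_{im}=x_{im}x_{jn}$ ($i<j$, $n<m$), $x_{jm}x_{in}-x_{in}x_{jm}=(q-q^{-1})x_{im}x_{jn}$ ($i<j$, $n<m$), $\sum_{p\in S_N}(-q)^{-l(p)}x_{1p(1)}\cdots x_{Np(N)}=1$, $\Delta(x_{ij})=\sum_kx_{ik}\otimes x_{kj}$, $\varepsilon(x_{ij})=\delta_{ij}$; its antipode $S$ satisfies $S^2(x_{ij})=q^{2(j-i)}x_{ij}$. $\sigma$ is the CQT structure (convolution invertible skew pairing, $\sigma(hh',g)=\sigma(h,g_1)\sigma(h',g_2)$,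 $\sigma(g,hh')=\sigma(g_2,h)\sigma(g_1,h')$, unital, $\sigma(h_1,h'_1)h_2h'_2=h'_1h_1\sigma(h_2,h'_2)$) determined by $\sigma(x_{im},x_{jn})=z\big(q^{\delta_{ij}}\delta_{mi}\delta_{nj}+[j>i](q-q^{-1})\delta_{mj}\delta_{ni}\big)$; its convolution inverse is obtained by replacing $q,z$ by $q^{-1},z^{-1}$. $H_\sigma\subseteq {\rm SL}_q(N)^0$ is the sub-Hopf algebra spanned by products $\sigma(-,x)\sigma(a,-)$, $x,a\in{\rm SL}_q(N)$ (identified with $U_q^{\rm ext}({\rm sl}_N)$). The braided Hopf algebra $\underline{{\rm SL}_q(N)}$ is the vector space ${\rm SL}_q(N)$ with the operations $\circ,\underline\Delta,\underline S$ displayed in the claim (Sweedler notation). *)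

(* Defs.v *)
From HB Require Import structures.
From mathcomp Require Import all_boot all_order all_algebra all_fingroup.

Set Implicit Arguments.
Unset Strict Implicit.
Unset Printing Implicit Defensive.

Import GRing.Theory.
Local Open Scope ring_scope.

(* Conventions.                                                             *)
(*  - Indices 1..N of the paper are the ordinals 'I_N; the paper's index     *)
(*    value of i : 'I_N is ix i = i+1 (this matters in exponents q^(2s)).    *)
(*  - There is no tensor product in the libraries.  An element of H (x) H is *)
(*    represented by a finite list of pairs s = [(a_1,b_1);...] standing for *)
(*    sum_r a_r (x) b_r; such a tensor is observed through the universal     *)
(*    property, i.e. by evaluating sum_r f a_r b_r for every bilinear map f  *)
(*    into every k-vector space W (teval).  The coproduct is a function      *)
(*    cop : H -> seq (H * H) returning a representative of Delta(h);         *)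
(*    Hopf-algebra axioms are stated at the tensor level.                    *)
(*  - Sweedler notation x_1 (x) ... (x) x_{n+1} is the list sw cop n x of    *)
(*    leg-lists obtained by iterating (id (x) Delta) Delta.                  *)

Section Defs.
Variables (k : fieldType) (H : algType k).

Definition teval (W : lmodType k) (s : seq (H * H)) (f : H -> H -> W) : W :=
  \sum_(p <- s) f p.1 p.2.

Definition lin (W : lmodType k) (g : H -> W) : Prop :=
  forall (c : k) (u v : H), g (c *: u + v) = c *: g u + g v.
Definition bilin (W : lmodType k) (f : H -> H -> W) : Prop :=
  (forall b, lin (fun a => f a b)) /\ (forall a, lin (f a)).
Definition trilin (W : lmodType k) (f : H -> H -> H -> W) : Prop :=
  [/\ forall b c, lin (fun a => f a b c), forall a c, lin (fun b => f a b c)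
    & forall a b, lin (f a b)].

Definition slin (g : H -> k) : Prop :=
  forall (c : k) (u v : H), g (c *: u + v) = c * g u + g v.
Definition sbilin (f : H -> H -> k) : Prop :=
  (forall b, slin (fun a => f a b)) /\ (forall a, slin (f a)).

Definition cop_linear (cop : H -> seq (H * H)) : Prop :=
  forall (W : lmodType k) (f : H -> H -> W), bilin f ->
  forall (c : k) (h h' : H),
    teval (cop (c *: h + h')) f = c *: teval (cop h) f + teval (cop h') f.

Definition cop_coassoc (cop : H -> seq (H * H)) : Prop :=
  forall (W : lmodType k) (f : H -> H -> H -> W), trilin f -> forall h : H,
    \sum_(p <- cop h) \sum_(p' <- cop p.1) f p'.1 p'.2 p.2
    = \sum_(p <- cop h) \sum_(p' <- cop p.2) f p.1 p'.1 p'.2.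

Definition cop_multiplicative (cop : H -> seq (H * H)) : Prop :=
  (forall (W : lmodType k) (f : H -> H -> W), bilin f -> forall h h' : H,
    teval (cop (h * h')) f
    = \sum_(p <- cop h) \sum_(p' <- cop h') f (p.1 * p'.1) (p.2 * p'.2)) /\
  (forall (W : lmodType k) (f : H -> H -> W), bilin f ->
    teval (cop 1) f = f 1 1).

Definition counit_ax (cop : H -> seq (H * H)) (eps : H -> k) : Prop :=
  [/\ slin eps, (forall u v, eps (u * v) = eps u * eps v), eps 1 = 1,
      (forall h, \sum_(p <- cop h) eps p.1 *: p.2 = h)
    & (forall h, \sum_(p <- cop h) eps p.2 *: p.1 = h)].

Definition antipode_ax (cop : H -> seq (H * H)) (eps : H -> k) (S : H -> H) :
  Prop :=
  [/\ lin S,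
      (forall h, \sum_(p <- cop h) S p.1 * p.2 = (eps h)%:A)
    & (forall h, \sum_(p <- cop h) p.1 * S p.2 = (eps h)%:A)].

Definition is_hopf (cop : H -> seq (H * H)) (eps : H -> k) (S : H -> H) :
  Prop :=
  [/\ cop_linear cop, cop_coassoc cop, cop_multiplicative cop,
      counit_ax cop eps & antipode_ax cop eps S].

Definition conv (cop : H -> seq (H * H)) (s t : H -> H -> k) (h h' : H) : k :=
  \sum_(p <- cop h) \sum_(p' <- cop h') s p.1 p'.1 * t p.2 p'.2.

Definition is_cqt (cop : H -> seq (H * H)) (eps : H -> k)
  (sig : H -> H -> k) : Prop :=
  sbilin sig /\
  [/\
      (forall h h' g, sig (h * h') g = \sum_(p <- cop g) sig h p.1 * sig h' p.2),
      (forall g h h', sig g (h * h') = \sum_(p <- cop g) sig p.2 h * sig p.1 h'),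
      (forall h, sig 1 h = eps h /\ sig h 1 = eps h),
      (forall h h', \sum_(p <- cop h) \sum_(p' <- cop h') sig p.1 p'.1 *: (p.2 * p'.2)
                  = \sum_(p <- cop h) \sum_(p' <- cop h') sig p.2 p'.2 *: (p'.1 * p.1))
    &
      (exists tau : H -> H -> k, sbilin tau /\
         forall h h', conv cop sig tau h h' = eps h * eps h' /\
                      conv cop tau sig h h' = eps h * eps h')].

Fixpoint sw (cop : H -> seq (H * H)) (n : nat) (x : H) : seq (seq H) :=
  match n with
  | 0 => [:: [:: x]]
  | n'.+1 => flatten [seq [seq p.1 :: l | l <- sw cop n' p.2] | p <- cop x]
  end.
(* l`_0, l`_1, ... are the legs x_1, x_2, ... *)

Definition bcirc (cop : H -> seq (H * H)) (S : H -> H) (sig : H -> H -> k)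
  (x y : H) : H :=
  \sum_(lx <- sw cop 2 x) \sum_(ly <- sw cop 1 y)
     sig (S lx`_2 * S (S lx`_0)) ly`_1 *: (lx`_1 * ly`_0).

Definition bDelta (cop : H -> seq (H * H)) (S : H -> H) (sig : H -> H -> k)
  (x : H) : seq (H * H) :=
  [seq (sig (S l`_0 * l`_2) (S l`_3 * l`_5) *: l`_1, l`_4) | l <- sw cop 5 x].

Definition bS (cop : H -> seq (H * H)) (S : H -> H) (sig : H -> H -> k)
  (x : H) : H :=
  \sum_(l <- sw cop 3 x) sig (S (S l`_2) * S l`_0) l`_3 *: S l`_1.

Variable N : nat.

Definition plen (p : 'S_N) : nat :=
  #|[set ij : 'I_N * 'I_N | (ij.1 < ij.2)%N && (p ij.2 < p ij.1)%N]|.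

Definition SLq_rel (A : algType k) (q : k) (a : 'I_N -> 'I_N -> A) : Prop :=
  [/\ (forall i m n : 'I_N, (n < m)%N -> a i m * a i n = q *: (a i n * a i m)),
      (forall i j m : 'I_N, (i < j)%N -> a j m * a i m = q *: (a i m * a j m)),
      (forall i j n m : 'I_N, (i < j)%N -> (n < m)%N ->
          a j n * a i m = a i m * a j n),
      (forall i j n m : 'I_N, (i < j)%N -> (n < m)%N ->
          a j m * a i n - a i n * a j m = (q - q^-1) *: (a i m * a j n))
    & \sum_(p : 'S_N) (- q) ^ (- (plen p)%:Z) *: \prod_(i < N) a i (p i) = 1].

Definition SLq_presentation (q : k) (x : 'I_N -> 'I_N -> H) : Prop :=
  [/\ SLq_rel q x,
      (forall h : H, exists s : seq (k * seq ('I_N * 'I_N)),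
          h = \sum_(c <- s) c.1 *: \prod_(ij <- c.2) x ij.1 ij.2)
    & (forall (A : algType k) (a : 'I_N -> 'I_N -> A), SLq_rel q a ->
         exists f : H -> A,
           [/\ forall (c : k) (u v : H), f (c *: u + v) = c *: f u + f v,
               forall u v, f (u * v) = f u * f v,
               f 1 = 1
             & forall i j, f (x i j) = a i j])].

Definition SLq_coalg_gens (cop : H -> seq (H * H)) (eps : H -> k)
  (x : 'I_N -> 'I_N -> H) : Prop :=
  (forall (W : lmodType k) (f : H -> H -> W), bilin f -> forall i j : 'I_N,
     teval (cop (x i j)) f = \sum_(l < N) f (x i l) (x l j)) /\
  (forall i j : 'I_N, eps (x i j) = (i == j)%:R).

Definition ind (b : bool) : k := (b : nat)%:R.

Definition sigma_gens (q z : k) (x : 'I_N -> 'I_N -> H) (sig : H -> H -> k) :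
  Prop :=
  forall i m j n : 'I_N,
    sig (x i m) (x j n)
    = z * (q ^+ (i == j) * ind (m == i) * ind (n == j)
           + ind (i < j)%N * (q - q^-1) * ind (m == j) * ind (n == i)).

Definition ix (i : 'I_N) : int := Posz i.+1.
Definition dl (a b : 'I_N) : int := Posz (a == b).

Variables (q : k) (x : 'I_N -> 'I_N -> H).

Definition xplus (l : 'I_N) : H :=
  \sum_(s < N | (l < s)%N) q ^ (2 * ix s) *: x s s.
Definition xminus (l : 'I_N) : H :=
  \sum_(s < N | (l < s)%N) q ^ (- (2 * ix s)) *: x s s.

Definition circ_formula (i m j n : 'I_N) : H :=
  q ^ (dl i n - dl m n) *: (x i m * x j n)
  + ((q - q^-1) * ind (i == n)) *:
      \sum_(s < N | (n < s)%N) q ^ (2 * (ix s - ix i) - dl s m) *: (x s m * x j s)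
  - (ind (n < m)%N * q ^ (dl i n) * (q - q^-1)) *: (x i n * x j m)
  - (ind (n.+1 < m)%N * (q - q^-1) ^+ 2 * ind (i == n)) *:
      \sum_(s < N | (n < s)%N && (s < m)%N)
         q ^ (2 * (ix s - ix i)) *: (x s s * x j m).

Definition delta_formula (W : lmodType k) (f : H -> H -> W) (i m : 'I_N) : W :=
  q ^ (- (2 * Posz N) - 1) *: (
      q ^ (- dl i m) *:
        \sum_(s < N) q ^ (2 * ix s + dl s i + dl s m) *: f (x i s) (x s m)
    + (q - q^-1) *: (
          f (x i m) (xplus m)
        - ind (i == m) *:
            \sum_(s < N) \sum_(t < N | (i < t)%N)
               q ^ (2 * (ix s + dl s i)) *: f (x t s) (x s t)
        + f (xplus i) (x i m))
    + (q - q^-1) ^+ 2 *: (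
          \sum_(s < N | (i < s)%N && (m < s)%N)
             q ^ (2 * ix s - 1) *: f (x s m) (x i s)
        - (ind (m < i)%N * q ^ (2 * ix i + 1)) *:
             \sum_(s < N | (i < s)%N) f (x s m) (x i s)
        - (ind (i < m)%N * q ^ (2 * ix m + 1)) *:
             \sum_(s < N | (m < s)%N) f (x s m) (x i s))
    - (q - q^-1) ^+ 3 *:
        \sum_(s < N | (i < s)%N && (m < s)%N) \sum_(t < N | (s < t)%N)
           q ^ (2 * ix s) *: f (x t m) (x i t)).

Definition S_formula (S : H -> H) (i m : 'I_N) : H :=
  q ^ (2 * Posz N + 1) *:
    (q ^ (- (2 * ix m) - dl i m) *: S (x i m)
     - ((q - q^-1) * ind (i == m)) *: S (xminus m)).

End Defs.

(* Main.v *)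
(** On generators every structure map of the braided Hopf algebra is a
    contraction of the N^2 x N^2 matrices of sigma, of its convolution inverse
    sigma(S(-), -), and of sigma(-, S(-)).

    The first two are explicit: inverting sigma replaces (q, z) by
    (q^-1, z^-1).  For the third, the relation sigma(h_1, g_1) h_2 g_2 =
    g_1 h_1 sigma(h_2, g_2) on generators, multiplied on both sides by
    antipodes, gives a triangular system for
    T_ib = sum_p q^(2p) S(x_pb) x_ip whose solution is T_ib = q^(2i) delta_ib;
    hence S^2(x_im) = q^(2(m-i)) x_im, and
    sigma(S^2(x), S(y)) = sigma(S(x), y) expresses sigma(-, S(-)) through the
    inverse matrix.

    Each matrix has two Kronecker-delta terms, so contracting over a row, a
    column, or a mixed pair of indices leaves at most two terms; the loops in
    the coproduct and antipode contribute the telescoping sum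
    q q^(2b) + (q - q^-1) sum_(c > b) q^(2c) = q^(2N+1).  The factors z and
    z^-1 always cancel. *)
Require Import Defs.
From HB Require Import structures.
From mathcomp Require Import all_boot all_order all_algebra all_fingroup.
From mathcomp Require Import ring ssrAC.

Set Implicit Arguments.
Unset Strict Implicit.
Unset Printing Implicit Defensive.

Import GRing.Theory.
Local Open Scope ring_scope.

Local Arguments sw : simpl never.

(** * Hopf algebras with a coquasitriangular structure *)

Section CQTHopf.
Variables (k : fieldType) (H : algType k).
Implicit Types (W : lmodType k).

Lemma lin_id : lin (fun a : H => a). Proof. by []. Qed.

Lemma lin_comp W (g : H -> W) (f : H -> H) :
  lin g -> lin f -> lin (fun a => g (f a)).
Proof. by move=> hg hf c u v; rewrite hf hg. Qed.

Lemma lin_mulr (f : H -> H) (b : H) : lin f -> lin (fun a => f a * b).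
Proof. by move=> hf c u v; rewrite hf mulrDl scalerAl. Qed.

Lemma lin_mull (f : H -> H) (b : H) : lin f -> lin (fun a => b * f a).
Proof. by move=> hf c u v; rewrite hf mulrDr scalerAr. Qed.

Lemma lin_scaler W (c : k) (g : H -> W) : lin g -> lin (fun a => c *: g a).
Proof. by move=> hg d u v; rewrite hg scalerDr !scalerA mulrC. Qed.

Lemma lin_scalel W (g : H -> k) (w : W) : slin g -> lin (fun a => g a *: w).
Proof. by move=> hg d u v; rewrite hg scalerDl !scalerA. Qed.

Lemma lin_sum W (I : Type) (r : seq I) (g : I -> H -> W) :
  (forall i, lin (g i)) -> lin (fun a => \sum_(i <- r) g i a).
Proof.
move=> hg c u v; rewrite scaler_sumr -big_split /=.
by apply: eq_bigr => i _; rewrite hg.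
Qed.

Lemma slin_comp (g : H -> k) (f : H -> H) :
  slin g -> lin f -> slin (fun a => g (f a)).
Proof. by move=> hg hf c u v; rewrite hf hg. Qed.

Lemma slin_mull (c : k) (g : H -> k) : slin g -> slin (fun a => c * g a).
Proof. by move=> hg d u v; rewrite hg; ring. Qed.

Lemma slin_mulr (c : k) (g : H -> k) : slin g -> slin (fun a => g a * c).
Proof. by move=> hg d u v; rewrite hg; ring. Qed.

Lemma lin0 W (g : H -> W) : lin g -> g 0 = 0.
Proof. by move=> hg; have := hg (-1) 0 0; rewrite scaler0 addr0 scaleN1r addNr. Qed.

Lemma linZ W (g : H -> W) c a : lin g -> g (c *: a) = c *: g a.
Proof. by move=> hg; have := hg c a 0; rewrite !addr0 (lin0 hg) addr0. Qed.

Lemma linD W (g : H -> W) a b : lin g -> g (a + b) = g a + g b.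
Proof. by move=> hg; have := hg 1 a b; rewrite !scale1r. Qed.

Lemma linsum W (g : H -> W) (I : Type) (r : seq I) (P : pred I) (F : I -> H) :
  lin g -> g (\sum_(i <- r | P i) F i) = \sum_(i <- r | P i) g (F i).
Proof.
move=> hg; elim/big_rec2: _ => [|i y1 y2 _ <-]; first exact: lin0.
exact: linD.
Qed.

(* Lists with n.+1 entries, as produced by [sw cop n]. *)
Fixpoint mlin W (n : nat) (F : seq H -> W) : Prop :=
  match n with
  | 0 => lin (fun a => F [:: a])
  | n'.+1 => (forall l, lin (fun a => F (a :: l))) /\
             (forall a, mlin n' (fun l => F (a :: l)))
  end.

Variables (cop : H -> seq (H * H)) (eps : H -> k) (S : H -> H).

Lemma sum_swS W n h (F : seq H -> W) :
  \sum_(l <- sw cop n.+1 h) F l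
  = \sum_(p <- cop h) \sum_(l <- sw cop n p.2) F (p.1 :: l).
Proof.
rewrite [sw _ _ _]/= big_flatten big_map; apply: eq_bigr => p _.
by rewrite big_map.
Qed.

Lemma sum_sw0 W h (F : seq H -> W) :
  \sum_(l <- sw cop 0 h) F l = F [:: h].
Proof. exact: big_seq1. Qed.

Hypothesis hopf : is_hopf cop eps S.

Lemma sum_cop_lin W (f : H -> H -> W) :
  bilin f -> lin (fun h => \sum_(p <- cop h) f p.1 p.2).
Proof. by move=> hf c u v; case: hopf => copl _ _ _ _; exact: (copl _ _ hf). Qed.

Lemma sum_sw_lin W n (F : seq H -> W) :
  mlin n F -> lin (fun h => \sum_(l <- sw cop n h) F l).
Proof.
elim: n F => [|n IHn] F hF c u v; first by rewrite !sum_sw0 hF.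
rewrite !sum_swS; case: hF => hF1 hF2.
apply: (sum_cop_lin (f := fun a b => \sum_(l <- sw cop n b) F (a :: l))).
split=> [b|a]; last exact: IHn (hF2 a).
by apply: lin_sum => l; exact: hF1.
Qed.

Lemma cop_counitl W (g : H -> W) h :
  lin g -> \sum_(p <- cop h) eps p.1 *: g p.2 = g h.
Proof.
move=> hg; case: hopf => _ _ _ [_ _ _ e _] _.
by rewrite -{2}(e h) linsum //; apply: eq_bigr => p _; rewrite linZ.
Qed.

Lemma cop_counitr W (g : H -> W) h :
  lin g -> \sum_(p <- cop h) eps p.2 *: g p.1 = g h.
Proof.
move=> hg; case: hopf => _ _ _ [_ _ _ _ e] _.
by rewrite -{2}(e h) linsum //; apply: eq_bigr => p _; rewrite linZ.
Qed.

Lemma antipode_lin : lin S. Proof. by case: hopf => _ _ _ _ []. Qed.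
Lemma counit_slin : slin eps. Proof. by case: hopf => _ _ _ [] . Qed.
Lemma counitM u v : eps (u * v) = eps u * eps v.
Proof. by case: hopf => _ _ _ [] . Qed.
Lemma counit1 : eps 1 = 1. Proof. by case: hopf => _ _ _ [] . Qed.

Lemma sum_copl_antipode W (g : H -> W) h :
  lin g -> \sum_(p <- cop h) g (S p.1 * p.2) = eps h *: g 1.
Proof.
move=> hg; case: hopf => _ _ _ _ [_ e _].
by rewrite -(linZ _ _ hg) -e linsum.
Qed.

Lemma sum_copr_antipode W (g : H -> W) h :
  lin g -> \sum_(p <- cop h) g (p.1 * S p.2) = eps h *: g 1.
Proof.
move=> hg; case: hopf => _ _ _ _ [_ _ e].
by rewrite -(linZ _ _ hg) -e linsum.
Qed.

Lemma counit_antipode h : eps (S h) = eps h.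
Proof.
have := @sum_copl_antipode k^o eps h counit_slin.
rewrite counit1 [_ *: _]mulr1 => <-.
under eq_bigr => p _ do rewrite counitM mulrC.
have hl : lin (eps \o S : H -> k^o) := slin_comp counit_slin antipode_lin.
by rewrite -[LHS]/((eps \o S : H -> k^o) h) -(cop_counitr h hl).
Qed.

Lemma antipode1 : S 1 = 1.
Proof.
case: hopf => _ _ [_ c1] _ [_ e _].
have hb : bilin (fun a b => S a * b).
  split=> [b|a]; first exact: lin_mulr antipode_lin.
  exact: lin_mull lin_id.
by have := c1 _ _ hb; rewrite /teval (e 1) counit1 scale1r mulr1 => <-.
Qed.

Lemma sum_sw2_antipodel W (g : H -> H -> W) h :
  bilin g ->
  \sum_(p <- cop h) \sum_(p' <- cop p.2) g (S p.1 * p'.1) p'.2 = g 1 h.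
Proof.
move=> [hg1 hg2]; case: hopf => _ coa _ _ _.
rewrite -(coa _ (fun a b c => g (S a * b) c)); last first.
  split=> *; last exact: hg2.
  - exact: (lin_comp (hg1 _) (lin_mulr _ antipode_lin)).
  - exact: (lin_comp (hg1 _) (lin_mull _ lin_id)).
under eq_bigr => p _ do
  rewrite (sum_copl_antipode p.1 (g := fun a => g a p.2)) //.
exact: cop_counitl.
Qed.

Lemma sum_sw1 W h (F : seq H -> W) :
  \sum_(l <- sw cop 1 h) F l = \sum_(p <- cop h) F [:: p.1; p.2].
Proof. by rewrite sum_swS; apply: eq_bigr => p _; rewrite sum_sw0. Qed.

Lemma sum_sw2 W h (F : seq H -> W) :
  \sum_(l <- sw cop 2 h) F l
  = \sum_(p <- cop h) \sum_(p' <- cop p.2) F [:: p.1; p'.1; p'.2].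
Proof. by rewrite sum_swS; apply: eq_bigr => p _; rewrite sum_sw1. Qed.

Variable sig : H -> H -> k.
Hypothesis cqt : is_cqt cop eps sig.

Lemma sig_slinl b : slin (sig^~ b). Proof. by case: cqt => -[]. Qed.
Lemma sig_slinr a : slin (sig a). Proof. by case: cqt => -[]. Qed.
Lemma sigM h h' g : sig (h * h') g = \sum_(p <- cop g) sig h p.1 * sig h' p.2.
Proof. by case: cqt => _ []. Qed.
Lemma sigMr g h h' : sig g (h * h') = \sum_(p <- cop g) sig p.2 h * sig p.1 h'.
Proof. by case: cqt => _ []. Qed.
Lemma sig1l h : sig 1 h = eps h. Proof. by case: cqt => _ [_ _ /(_ h)[]]. Qed.
Lemma sig1r h : sig h 1 = eps h. Proof. by case: cqt => _ [_ _ /(_ h)[]]. Qed.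

Let lS := antipode_lin.
Let lSS : lin (fun a => S (S a)) := lin_comp lS lS.

Lemma sum_sw_1 W n (F : seq H -> W) :
  mlin n F -> \sum_(l <- sw cop n 1) F l = F (nseq n.+1 1).
Proof.
elim: n F => [|n IHn] F hF; first by rewrite sum_sw0.
rewrite sum_swS; case: hF => hF1 hF2; case: hopf => _ _ [_ c1] _ _.
rewrite -[LHS]/(teval _ (fun a b => \sum_(l <- sw cop n b) F (a :: l))).
rewrite c1; first exact: IHn (hF2 1).
split=> [b|a]; last exact: sum_sw_lin (hF2 a).
by apply: lin_sum => l; exact: hF1.
Qed.

Lemma sum_sw2_counit h : \sum_(l <- sw cop 2 h) (eps l`_0 * eps l`_2) *: l`_1 = h.
Proof.
rewrite sum_sw2 /=.
under eq_bigr => p _.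
  under eq_bigr => p' _ do rewrite -scalerA.
  rewrite -scaler_sumr (cop_counitr p.2 lin_id).
  over.
exact: cop_counitl lin_id.
Qed.

Lemma bcirc_unit y : bcirc cop S sig 1 y = y /\ bcirc cop S sig y 1 = y.
Proof.
split; rewrite /bcirc.
- rewrite (@sum_sw_1 _ 2 (fun lx => \sum_(ly <- sw cop 1 y)
     sig (S lx`_2 * S (S lx`_0)) ly`_1 *: (lx`_1 * ly`_0))) /=; last first.
    split=> [l|a]; last split=> [l|b]; last 1 [move=> c|]; apply: lin_sum => ly /=.
    + exact/lin_scalel/(slin_comp (sig_slinl _))/lin_mull.
    + exact/lin_scaler/lin_mulr/lin_id.
    + exact/lin_scalel/(slin_comp (sig_slinl _))/lin_mulr.
  rewrite !antipode1 mulr1 sum_sw1 /=.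
  under eq_bigr => p _ do rewrite sig1l mul1r.
  exact: cop_counitr lin_id.
- under eq_bigr => lx _.
    rewrite (@sum_sw_1 _ 1 (fun ly => sig (S lx`_2 * S (S lx`_0)) ly`_1
                  *: (lx`_1 * ly`_0))) /=; last first.
      split=> [l|a]; first exact/lin_scaler/lin_mull/lin_id.
      exact/lin_scalel/sig_slinr.
    rewrite sig1r counitM !counit_antipode mulr1 mulrC.
    over.
  exact: sum_sw2_counit.
Qed.

Lemma bDelta_counit y :
  \sum_(p <- bDelta cop S sig y) eps p.1 *: p.2 = y /\
  \sum_(p <- bDelta cop S sig y) eps p.2 *: p.1 = y.
Proof.
have le := counit_slin.
split; rewrite big_map /= !sum_swS.
- pose G c d := \sum_(l <- sw cop 2 d) sig c (S l`_0 * l`_2) *: l`_1.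
  have hG : bilin G.
    split=> [b|a]; first by apply: lin_sum => l; exact/lin_scalel/sig_slinl.
    apply: sum_sw_lin; split=> [l|b /=]; last split=> [l|c] /=.
    + exact/lin_scalel/(slin_comp (sig_slinr _))/lin_mulr.
    + exact/lin_scaler/lin_id.
    + exact/lin_scalel/(slin_comp (sig_slinr _))/lin_mull/lin_id.
  transitivity (\sum_(p <- cop y) \sum_(p' <- cop p.2) G (S p.1 * p'.1) p'.2).
    apply: eq_bigr => p _; rewrite sum_swS.
    under eq_bigr => p' _.
      under eq_bigr => l _ do
        rewrite /= (linZ (W := k^o)) // [X in X *: _]mulrC -scalerA.
      rewrite -scaler_sumr sum_swS.
      over.
    rewrite (cop_counitl p.2 (g := fun h => \sum_(p' <- cop h)
      \sum_(l <- sw cop 2 p'.2) sig (S p.1 * p'.1) (S l`_0 * l`_2) *: l`_1)) //.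
    apply: (sum_cop_lin (f := fun a b => G (S p.1 * a) b)); split=> [b|a]; last exact: hG.2.
    by apply: (lin_comp (g := G^~ b)); [exact: hG.1 | exact/lin_mull/lin_id].
  rewrite sum_sw2_antipodel // /G.
  under eq_bigr => l _ do rewrite sig1l counitM counit_antipode.
  exact: sum_sw2_counit.
- have hsw c d : \sum_(l <- sw cop 2 d) eps l`_1 * sig c (S l`_0 * l`_2)
      = eps c * eps d.
    rewrite (@sum_sw2 k^o) /=.
    under eq_bigr => p _.
      rewrite (cop_counitl (W := k^o) p.2 (g := fun b => sig c (S p.1 * b)));
        last exact/(slin_comp (sig_slinr _))/lin_mull/lin_id.
      over.
    by rewrite (sum_copl_antipode (W := k^o) d (sig_slinr c)) sig1r mulrC.
  rewrite -[RHS]sum_sw2_counit sum_sw2.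
  apply: eq_bigr => p _; rewrite sum_swS; apply: eq_bigr => p2 _ /=.
  have -> : eps p2.2 = \sum_(p3 <- cop p2.2) eps p3.1 * eps p3.2.
    by rewrite (cop_counitl (W := k^o) p2.2 counit_slin).
  rewrite sum_swS mulr_sumr scaler_suml; apply: eq_bigr => p3 _.
  rewrite -(counit_antipode p.1) mulrA -counitM -hsw scaler_suml.
  by apply: eq_bigr => l _; rewrite scalerA.
Qed.
End CQTHopf.

(** * The matrix of sigma *)

Section RMatrix.
Variables (k : fieldType) (N : nat).
Implicit Types (W : lmodType k) (i j m n : 'I_N).

Definition Rmat (q z : k) i m j n : k :=
  z * (q ^+ (i == j) * ind k (m == i) * ind k (n == j)
       + ind k (i < j)%N * (q - q^-1) * ind k (m == j) * ind k (n == i)).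

Lemma sum_ind W i (F : 'I_N -> W) : \sum_a ind k (a == i) *: F a = F i.
Proof.
rewrite (bigD1 i) //= /ind eqxx scale1r big1 ?addr0 // => a /negPf ->.
by rewrite scale0r.
Qed.

Lemma sum_ind_cond W (P : pred 'I_N) (F : 'I_N -> W) :
  \sum_a ind k (P a) *: F a = \sum_(a | P a) F a.
Proof.
rewrite [RHS]big_mkcond; apply: eq_bigr => a _.
by rewrite /ind; case: (P a); rewrite ?scale1r ?scale0r.
Qed.

Lemma indC m i : ind k (m == i) = ind k (i == m). Proof. by rewrite eq_sym. Qed.

Lemma sum_ind2 W i j (F : 'I_N -> 'I_N -> W) :
  \sum_a \sum_b (ind k (a == i) * ind k (b == j)) *: F a b = F i j.
Proof.
under eq_bigr => a _ do
  (under eq_bigr => b _ do rewrite -scalerA; rewrite -scaler_sumr sum_ind).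
exact: sum_ind.
Qed.

Section Contractions.
Variables (q z : k) (W : lmodType k) (F : 'I_N -> 'I_N -> W).
Let R := Rmat q z.

Lemma Rmat_row i j :
  \sum_m \sum_n R i m j n *: F m n
  = z *: (q ^+ (i == j) *: F i j + (ind k (i < j)%N * (q - q^-1)) *: F j i).
Proof.
rewrite -(sum_ind2 i j F) -(sum_ind2 j i F) !scaler_sumr -big_split /=.
rewrite scaler_sumr; apply: eq_bigr => m _.
rewrite !scaler_sumr -big_split /= scaler_sumr; apply: eq_bigr => n _.
by rewrite !scalerA -scalerDl scalerA /R /Rmat !mulrA.
Qed.

Lemma Rmat_swap i m j n : R n j m i = R i m j n.
Proof.
rewrite /R /Rmat; congr (z * (_ + _)).
  rewrite /ind; case: (eqVneq m i) => [->|_]; case: (eqVneq n j) => [->|_];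
    rewrite ?mulr0 ?mul0r //.
  by rewrite eq_sym.
rewrite /ind; case: (eqVneq m j) => [->|_]; case: (eqVneq n i) => [->|_];
  by rewrite ?mulr0 ?mul0r.
Qed.

Lemma Rmat_mid i n :
  \sum_m \sum_j R i m j n *: F m j
  = z *: (q ^+ (i == n) *: F i n
          + (ind k (i == n) * (q - q^-1)) *: \sum_(t < N | (i < t)%N) F t t).
Proof.
transitivity (\sum_m \sum_j z *: ((ind k (m == i) * ind k (j == n)) *:
     (q ^+ (i == j) *: F m j) +
   (ind k (m == j) * ind k (i < j)%N) *: ((ind k (i == n) * (q - q^-1)) *: F m j))).
  apply: eq_bigr => m _; apply: eq_bigr => j _.
  rewrite !scalerA -scalerDl scalerA /R /Rmat (indC n j) (indC n i).
  by congr (_ *: _); ring.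
under eq_bigr => m _ do rewrite -scaler_sumr big_split.
rewrite -scaler_sumr big_split /= sum_ind2; congr (_ *: (_ + _)).
rewrite exchange_big /= -(sum_ind_cond _ (fun t => F t t)) scaler_sumr.
apply: eq_bigr => j _.
under eq_bigr => m _ do rewrite -scalerA.
by rewrite sum_ind !scalerA mulrC.
Qed.

End Contractions.

Lemma Rmat_col (q z : k) W (F : 'I_N -> 'I_N -> W) m n :
  \sum_i \sum_j Rmat q z i m j n *: F i j
  = z *: (q ^+ (m == n) *: F m n + (ind k (n < m)%N * (q - q^-1)) *: F n m).
Proof.
rewrite exchange_big /=.
under eq_bigr => j _ do under eq_bigr => i _ do rewrite -Rmat_swap.
by rewrite (Rmat_row q z (fun j i => F i j)) eq_sym.
Qed.

Lemma Rmat_trace (q z : k) (w : 'I_N -> k) i n :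
  \sum_c w c * Rmat q z i c c n
  = z * ind k (i == n) * (q * w i + (q - q^-1) * \sum_(c < N | (i < c)%N) w c).
Proof.
have := Rmat_mid q z (W := k^o) (fun m j => ind k (j == m) * w m) i n.
under eq_bigr => m _.
  under eq_bigr => j _ do rewrite [_ *: _]mulrCA.
  rewrite (sum_ind (W := k^o)) mulrC; over.
move=> ->.
under eq_bigr => c _ do rewrite {1}/ind eqxx mul1r.
rewrite -[RHS]mulrA; congr (_ * _).
rewrite /ind; case: (eqVneq i n) => _ /=.
  by rewrite !mul1r.
by rewrite !mul0r scaler0 scale0r addr0.
Qed.

Lemma Rmat_left_inverse (q z : k) (X : 'I_N -> 'I_N -> 'I_N -> 'I_N -> k) :
  q != 0 -> z != 0 ->
  (forall i m j n, \sum_a \sum_b X i a j b * Rmat q z a m b n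
                   = ind k (i == m) * ind k (j == n)) ->
  forall i m j n, X i m j n = Rmat q^-1 z^-1 i m j n.
Proof.
move=> q0 z0 hX i m j n.
have E u v : z * (q ^+ (u == v) * X i u j v + ind k (v < u)%N * (q - q^-1) * X i v j u)
   = ind k (i == u) * ind k (j == v).
  rewrite -hX; under eq_bigr => a _ do under eq_bigr => b _ do rewrite mulrC.
  by rewrite (Rmat_col q z (W := k^o) (fun a b => X i a j b)).
have h1 := E m n; have h2 := E n m; move: h1 h2 {E hX}.
rewrite -Rmat_swap /Rmat !invrK /ind.
case: (ltngtP m n) => [lt|lt|/val_inj ->].
- rewrite -!val_eqE /= (ltn_eqF lt) (gtn_eqF lt) !expr0 mulr0n => h _.
  apply: (mulfI z0); rewrite mulVKf //; move: h.
  by rewrite !mul0r !mul1r !addr0 mulrC [RHS]mulrC [LHS]mulrC.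
- rewrite -!val_eqE /= (ltn_eqF lt) (gtn_eqF lt) !expr0 mulr0n mulr1n.
  rewrite !mul0r !mul1r !addr0 => h1 h2.
  apply: (mulfI z0); rewrite mulVKf //.
  transitivity (z * (X i m j n + (q - q^-1) * X i n j m)
                - (q - q^-1) * (z * X i n j m)); first by ring.
  by rewrite h1 h2; ring.
- rewrite !eqxx !expr1 mulr0n !mul0r !addr0 => h _.
  apply: (mulfI z0); rewrite mulVKf //; apply: (mulfI q0).
  by rewrite -[q^-1 * _ * _]mulrA mulVKf // mulrCA h mulrC.
Qed.
End RMatrix.

Section Geometric.
Variables (k : fieldType) (N : nat).

Lemma geometric_ix (r : k) (b : 'I_N) : r != 0 ->
  r * r ^ (2 * ix b) + (r - r^-1) * \sum_(c < N | (b < c)%N) r ^ (2 * ix c)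
  = r ^ (2 * Posz N + 1).
Proof.
move=> r0.
have e (c : nat) : (r - r^-1) * r ^ (2 * Posz c.+1) = r ^+ (c.+1.*2.+1) - r ^+ (c.*2.+1).
  rewrite -[2 * _]/(Posz (2 * c.+1)) -exprnP mul2n doubleS mulrBl -exprS exprS.
  by rewrite mulKf.
rewrite mulr_sumr (eq_bigr (fun c : 'I_N => r ^+ (c.+1.*2.+1) - r ^+ (c.*2.+1))); last first.
  by move=> c _; exact: e.
rewrite -(big_geq_mkord b.+1 N xpredT (fun c => r ^+ (c.+1.*2.+1) - r ^+ (c.*2.+1))).
rewrite (telescope_sumr (fun c => r ^+ (c.*2.+1))) ?ltn_ord //.
rewrite -[2 * ix b]/(Posz (2 * b.+1)) -exprnP -exprS mul2n addrC subrK.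
by rewrite -[_ + 1]/(Posz (2 * N + 1)) -exprnP addn1 mul2n.
Qed.
End Geometric.

(** * The structure maps on generators *)

Section Generators.
Variables (k : fieldType) (q z : k) (N : nat) (H : algType k).
Variables (x : 'I_N -> 'I_N -> H) (cop : H -> seq (H * H)) (eps : H -> k).
Variables (S : H -> H) (sig : H -> H -> k).
Hypotheses (q0 : q != 0) (z0 : z != 0).
Hypothesis hopf : is_hopf cop eps S.
Hypothesis gens : SLq_coalg_gens cop eps x.
Hypothesis cqt : is_cqt cop eps sig.
Hypothesis sgens : sigma_gens q z x sig.
Implicit Types (W : lmodType k) (i j m n : 'I_N).

Let lS := antipode_lin hopf.
Let lid := @lin_id k H.
Let sigl := sig_slinl cqt.
Let sigr := sig_slinr cqt.
Let L := q - q^-1.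

Lemma sum_cop_gen W (f : H -> H -> W) i j :
  bilin f -> \sum_(p <- cop (x i j)) f p.1 p.2 = \sum_l f (x i l) (x l j).
Proof. by move=> hf; case: gens => + _; apply. Qed.

Lemma counit_gen i j : eps (x i j) = ind k (i == j).
Proof. by case: gens. Qed.

Lemma sum_sw_gen W (n : nat) (F : seq H -> W) i m : mlin n.+1 F ->
  \sum_(l <- sw cop n.+1 (x i m)) F l
  = \sum_a \sum_(l <- sw cop n (x a m)) F (x i a :: l).
Proof.
move=> [hF1 hF2]; rewrite sum_swS.
apply: (sum_cop_gen (f := fun a b => \sum_(l <- sw cop n b) F (a :: l))).
split=> [b|a]; first by apply: lin_sum => l; exact: hF1.
exact: (sum_sw_lin hopf (hF2 a)).
Qed.

Lemma sum_antipodel_gen W (g : H -> W) i j :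
  lin g -> \sum_l g (S (x i l) * x l j) = ind k (i == j) *: g 1.
Proof.
move=> hg; rewrite -counit_gen -(sum_copl_antipode hopf _ hg).
rewrite (sum_cop_gen (f := fun a b => g (S a * b))) //.
by split=> ?; apply: lin_comp => //; [exact: lin_mulr | exact: lin_mull].
Qed.

Lemma sum_antipoder_gen W (g : H -> W) i j :
  lin g -> \sum_l g (x i l * S (x l j)) = ind k (i == j) *: g 1.
Proof.
move=> hg; rewrite -counit_gen -(sum_copr_antipode hopf _ hg).
rewrite (sum_cop_gen (f := fun a b => g (a * S b))) //.
by split=> ?; apply: lin_comp => //; [exact: lin_mulr | exact: lin_mull].
Qed.

Lemma sum_cop_antipode_gen W (f : H -> H -> W) i m : bilin f ->
  \sum_(p <- cop (S (x i m))) f p.1 p.2 = \sum_l f (S (x l m)) (S (x i l)).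
Proof.
move=> [hf1 hf2].
have hf p n : bilin (fun a b => f (a * S (x p m)) (b * S (x n p))).
  split=> [b|a]; first by apply: (lin_comp (hf1 _)); exact: lin_mulr.
  by apply: (lin_comp (hf2 _)); exact: lin_mulr.
transitivity (\sum_p \sum_n \sum_(r <- cop (\sum_j S (x i j) * x j n))
   f (r.1 * S (x p m)) (r.2 * S (x n p))); last first.
  apply: eq_bigr => p _; rewrite -[RHS](sum_ind i (fun n => f (S (x p m)) (S (x n p)))).
  apply: eq_bigr => n _; rewrite (sum_antipodel_gen _ _ lid) (linZ _ _ (sum_cop_lin hopf (hf p n))).
  congr (_ *: _); first by rewrite eq_sym.
  case: hopf => _ _ [_ c1] _ _.
  by have := c1 _ _ (hf p n); rewrite /teval /= => ->; rewrite !mul1r.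
rewrite -[LHS](sum_ind m (fun j => \sum_(p <- cop (S (x i j))) f p.1 p.2)).
transitivity (\sum_p \sum_n \sum_j \sum_(u <- cop (S (x i j))) \sum_l
   f (u.1 * (x j l * S (x p m))) (u.2 * (x l n * S (x n p)))).
  rewrite pair_bigA exchange_big; apply: eq_bigr => j _ /=.
  rewrite exchange_big scaler_sumr; apply: eq_bigr => u _ /=.
  rewrite exchange_big /=.
  transitivity (\sum_l f (u.1 * (x j l * S (x l m))) u.2).
    rewrite (sum_antipoder_gen (g := fun a => f (u.1 * a) u.2)) ?mulr1 //.
    by apply: (lin_comp (hf1 _)); exact: lin_mull.
  apply: eq_bigr => l _.
  rewrite -(pair_bigA _ (fun p n => f (u.1 * (x j l * S (x p m))) (u.2 * (x l n * S (x n p))))) /=.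
  rewrite -[LHS](sum_ind l (fun p => f (u.1 * (x j l * S (x p m))) u.2)).
  apply: eq_bigr => p _.
  rewrite (sum_antipoder_gen (g := fun a => f (u.1 * (x j l * S (x p m))) (u.2 * a))).
    by rewrite mulr1 eq_sym.
  by apply: (lin_comp (hf2 _)); exact: lin_mull.
apply: eq_bigr => p _; apply: eq_bigr => n _.
rewrite (linsum _ _ _ (sum_cop_lin hopf (hf p n))); apply: eq_bigr => j _.
case: hopf => _ _ [cM _] _ _.
have := cM _ _ (hf p n); rewrite /teval /= => ->; apply: eq_bigr => u _.
rewrite (sum_cop_gen (f := fun a b => f (u.1 * a * S (x p m)) (u.2 * b * S (x n p)))).
  by apply: eq_bigr => l _; rewrite !mulrA.
split=> ?.
  by apply: (lin_comp (hf1 _)); apply: lin_mulr; exact: lin_mull.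
by apply: (lin_comp (hf2 _)); apply: lin_mulr; exact: lin_mull.
Qed.

Lemma sig_gen i m j n : sig (x i m) (x j n) = Rmat q z i m j n.
Proof. exact: sgens. Qed.

Lemma sigM_gen h h' i m :
  sig (h * h') (x i m) = \sum_a sig h (x i a) * sig h' (x a m).
Proof.
rewrite (sigM cqt) (sum_cop_gen (W := k^o) (f := fun a b => sig h a * sig h' b)) //.
by split=> ?; [exact: slin_mulr | exact: slin_mull].
Qed.

Lemma sigMr_gen h h' i m :
  sig (x i m) (h * h') = \sum_a sig (x a m) h * sig (x i a) h'.
Proof.
rewrite (sigMr cqt) (sum_cop_gen (W := k^o) (f := fun a b => sig b h * sig a h')) //.
by split=> ?; [exact: slin_mull | exact: slin_mulr].
Qed.

Lemma sigMr_antipode_gen h h' i m :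
  sig (S (x i m)) (h * h') = \sum_a sig (S (x i a)) h * sig (S (x a m)) h'.
Proof.
rewrite (sigMr cqt).
rewrite (sum_cop_antipode_gen (W := k^o) (f := fun a b => sig b h * sig a h')) //.
by split=> ?; [exact: slin_mull | exact: slin_mulr].
Qed.

Lemma sigM_antipode_gen h h' i m :
  sig (h * h') (S (x i m)) = \sum_a sig h (S (x a m)) * sig h' (S (x i a)).
Proof.
rewrite (sigM cqt).
rewrite (sum_cop_antipode_gen (W := k^o) (f := fun a b => sig h a * sig h' b)) //.
by split=> ?; [exact: slin_mulr | exact: slin_mull].
Qed.

Lemma sig_antipode_gen i m j n :
  sig (S (x i m)) (x j n) = Rmat q^-1 z^-1 i m j n.
Proof.
apply: (Rmat_left_inverse (X := fun i m j n => sig (S (x i m)) (x j n)) q0 z0).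
move=> {}i {}m {}j {}n.
have := sum_antipodel_gen (W := k^o) i m (sigl (x j n)).
rewrite (sig1l cqt) counit_gen; apply: etrans.
apply: eq_bigr => a _; rewrite sigM_gen.
by apply: eq_bigr => b _; rewrite sig_gen.
Qed.

Lemma sig_antipode2_gen i m j n :
  sig (S (x i m)) (S (x j n)) = Rmat q z i m j n.
Proof.
rewrite -(invrK q) -(invrK z).
apply: (Rmat_left_inverse (X := fun i m j n => sig (S (x i m)) (S (x j n))));
  rewrite ?invr_neq0 //.
move=> {}i {}m {}j {}n; rewrite exchange_big /=.
have := sum_antipodel_gen (W := k^o) j n (sigr (S (x i m))).
rewrite (sig1r cqt) (counit_antipode hopf) counit_gen [_ *: _]mulrC; apply: etrans.
apply: eq_bigr => b _; rewrite sigMr_antipode_gen.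
by apply: eq_bigr => a _; rewrite sig_antipode_gen.
Qed.

Lemma sig_antipode3_gen i m j n :
  sig (S (S (x i m))) (S (x j n)) = Rmat q^-1 z^-1 i m j n.
Proof.
rewrite -Rmat_swap.
apply: (Rmat_left_inverse (X := fun n j m i => sig (S (S (x i m))) (S (x j n))) q0 z0).
move=> {}n {}j {}m {}i; rewrite exchange_big /=.
transitivity (\sum_b sig (S (S (x b m)) * S (x i b)) (S (x j n))).
  apply: eq_bigr => b _; rewrite sigM_antipode_gen; apply: eq_bigr => a _.
  by rewrite sig_antipode2_gen Rmat_swap.
rewrite -(sum_cop_antipode_gen (W := k^o) i m (f := fun a b => sig (S a * b) (S (x j n)))).
  rewrite (sum_copl_antipode (W := k^o) hopf _ (sigl (S (x j n)))).
  rewrite (sig1l cqt) !(counit_antipode hopf) !counit_gen [_ *: _]mulrC.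
  by rewrite (indC _ j) (indC _ i).
split=> b; apply: (slin_comp (sigl _)); [exact: lin_mulr | exact: lin_mull].
Qed.

Lemma RTT i m j n :
  q ^+ (i == j) *: (x i m * x j n) + (ind k (i < j)%N * L) *: (x j m * x i n)
  = q ^+ (m == n) *: (x j n * x i m) + (ind k (n < m)%N * L) *: (x j m * x i n).
Proof.
have Rl := Rmat_row q z (fun a b => x a m * x b n) i j.
have Rr := Rmat_col q z (fun a b => x j b * x i a) m n.
apply: (scalerI z0); rewrite -Rl -Rr {Rl Rr}.
case: (cqt) => _ [_ _ _ /(_ (x i m) (x j n)) + _].
rewrite (sum_cop_gen (f := fun a b => \sum_(p' <- cop (x j n))
  sig a p'.1 *: (b * p'.2))); last first.
  split=> ?; apply: lin_sum => ?; first exact/lin_scalel/sigl.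
  exact/lin_scaler/lin_mulr.
rewrite (sum_cop_gen (f := fun a b => \sum_(p' <- cop (x j n))
  sig b p'.2 *: (p'.1 * a))); last first.
  split=> ?; apply: lin_sum => ?; last exact/lin_scalel/sigl.
  exact/lin_scaler/lin_mull.
under eq_bigr => a _.
  rewrite (sum_cop_gen (f := fun c d => sig (x i a) c *: (x a m * d))); last first.
    by split=> ?; [exact/lin_scalel/sigr|exact/lin_scaler/lin_mull].
  under eq_bigr => b _ do rewrite sig_gen.
  over.
move=> ->; apply: eq_bigr => a _.
rewrite (sum_cop_gen (f := fun c d => sig (x a m) d *: (c * x i a))); last first.
  by split=> ?; [exact/lin_scaler/lin_mulr | exact/lin_scalel/sigr].
by apply: eq_bigr => b _; rewrite sig_gen.
Qed.

(* Conjugating RTT by the antipode matrix moves S(x) across x. *)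
Lemma antipode_RTT i b p m :
  q ^+ (i == b) *: (S (x p b) * x i m)
    + (ind k (i == b) * L) *: \sum_(j < N | (i < j)%N) S (x p j) * x j m
  = q ^+ (m == p) *: (x i m * S (x p b))
    + (ind k (m == p) * L) *: \sum_(a < N | (a < p)%N) x i a * S (x a b).
Proof.
pose T h := \sum_j \sum_n S (x p j) * h j n * S (x n b).
have TD g h : T (fun j n => g j n + h j n) = T g + T h.
  rewrite /T -big_split; apply: eq_bigr => j _; rewrite -big_split.
  by apply: eq_bigr => n _; rewrite mulrDr mulrDl.
have -> : q ^+ (i == b) *: (S (x p b) * x i m)
  = T (fun j n => q ^+ (i == j) *: (x i m * x j n)).
  rewrite -(sum_ind b (fun j => q ^+ (i == j) *: (S (x p j) * x i m))).
  apply: eq_bigr => j _.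
  have := sum_antipoder_gen (g := fun h => q ^+ (i == j) *: (S (x p j) * x i m * h)) j b
     (lin_scaler _ (lin_mull _ lid)).
  rewrite mulr1 => <-; apply: eq_bigr => n _.
  by rewrite -scalerAr -scalerAl !mulrA.
have -> : (ind k (i == b) * L) *: \sum_(j < N | (i < j)%N) S (x p j) * x j m
  = T (fun j n => (ind k (i < j)%N * L) *: (x j m * x i n)).
  rewrite -sum_ind_cond scaler_sumr; apply: eq_bigr => j _.
  have := sum_antipoder_gen (g := fun h => (ind k (i < j)%N * L) *: (S (x p j) * x j m * h)) i b
     (lin_scaler _ (lin_mull _ lid)).
  rewrite mulr1 !scalerA [in RHS]mulrA [_ * L * _]mulrAC => <-.
  by apply: eq_bigr => n _; rewrite -scalerAr -scalerAl !mulrA.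
have -> : q ^+ (m == p) *: (x i m * S (x p b))
  = T (fun j n => q ^+ (m == n) *: (x j n * x i m)).
  rewrite /T exchange_big /=.
  rewrite -(sum_ind p (fun n => q ^+ (m == n) *: (x i m * S (x n b)))).
  apply: eq_bigr => n _.
  have := sum_antipodel_gen (g := fun h => q ^+ (m == n) *: (h * (x i m * S (x n b)))) p n
     (lin_scaler _ (lin_mulr _ lid)).
  rewrite mul1r (eq_sym p) => <-; apply: eq_bigr => j _.
  by rewrite -scalerAr -scalerAl !mulrA.
have -> : (ind k (m == p) * L) *: \sum_(a < N | (a < p)%N) x i a * S (x a b)
  = T (fun j n => (ind k (n < m)%N * L) *: (x j m * x i n)).
  rewrite /T exchange_big /=.
  rewrite -sum_ind_cond scaler_sumr; apply: eq_bigr => n _.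
  have := sum_antipodel_gen (g := fun h => (ind k (n < m)%N * L) *: (h * (x i n * S (x n b)))) p m
     (lin_scaler _ (lin_mulr _ lid)).
  rewrite mul1r => E; transitivity
    (\sum_j (ind k (n < m)%N * L) *: (S (x p j) * x j m * (x i n * S (x n b)))).
    rewrite E !scalerA; congr (_ *: _); rewrite /ind.
    by case: (eqVneq m p) => [->|_]; rewrite ?mulr1n ?mulr0n; ring.
  by apply: eq_bigr => j _; rewrite -scalerAr -scalerAl !mulrA.
rewrite -!TD; apply: eq_bigr => j _; apply: eq_bigr => n _.
by rewrite RTT.
Qed.

Let qix i : k := q ^ (2 * ix i).

Lemma geometric_q i : q * qix i + L * \sum_(c < N | (i < c)%N) qix c = q ^ (2 * Posz N + 1).
Proof. exact: geometric_ix. Qed.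

Lemma sum_twisted_antipode i b :
  \sum_p qix p *: (S (x p b) * x i p) = (ind k (i == b) * qix i)%:A.
Proof.
pose T i b := \sum_p qix p *: (S (x p b) * x i p).
have E i' b' : q ^+ (i' == b') *: T i' b' + (ind k (i' == b') * L) *: \sum_(j < N | (i' < j)%N) T j j
     = (ind k (i' == b') * q ^ (2 * Posz N + 1))%:A.
  transitivity (\sum_p qix p *: (q ^+ (i' == b') *: (S (x p b') * x i' p)
    + (ind k (i' == b') * L) *: \sum_(j < N | (i' < j)%N) S (x p j) * x j p)).
    rewrite exchange_big /= !scaler_sumr -big_split; apply: eq_bigr => p _ /=.
    rewrite scalerDr -!scaler_sumr !scalerA; congr (_ *: _ + _ *: _);
      by rewrite mulrC.
  under eq_bigr => p _ do rewrite antipode_RTT eqxx /ind mul1r expr1 -sum_ind_cond.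
  transitivity (\sum_a q ^ (2 * Posz N + 1) *: (x i' a * S (x a b'))); last first.
    rewrite (sum_antipoder_gen (g := fun h => q ^ (2 * Posz N + 1) *: h)) ?scalerA //.
    exact: lin_scaler.
  under eq_bigr => p _ do rewrite scalerDr 2!scaler_sumr.
  rewrite big_split [X in _ + X = _]exchange_big -big_split; apply: eq_bigr => a _ /=.
  rewrite -(geometric_q a) scalerDl scalerA [q * _]mulrC; congr (_ + _).
  rewrite mulr_sumr -(sum_ind_cond (W := k^o) (fun c : 'I_N => a < c)%N (fun c => L * qix c)).
  rewrite scaler_suml; apply: eq_bigr => p _.
  rewrite !scalerA; congr (_ *: _).
  by rewrite -[RHS]/(ind k (a < p)%N * L * qix p); ring.
have [ib|ib] := eqVneq i b; last first.
  have := E i b; rewrite (negPf ib) /ind !mul0r !scale0r addr0 expr0 scale1r.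
  by [].
rewrite -{}ib /ind mul1r -/(T i i).
have [d] := ubnP (N - i); elim: d i => // d IHd i lt_d.
have := E i i; rewrite eqxx /ind !mul1r expr1.
rewrite (eq_bigr (fun j => (qix j)%:A)); last first.
  by move=> j lt_ij; apply: IHd; rewrite -ltnS (leq_trans _ lt_d) // ltnS ltn_sub2l.
rewrite -(geometric_q i) -scaler_suml scalerDl -scalerA.
by rewrite -[(L * _)%:A]scalerA => /addIr /(scalerI q0).
Qed.

Lemma qixB i j : q ^ (2 * (ix i - ix j)) = qix i * (qix j)^-1.
Proof. by rewrite mulrBr expfzDr. Qed.

Lemma qix_neq0 i : qix i != 0. Proof. by rewrite expfz_neq0. Qed.

Lemma antipode_sqr_gen i m : S (S (x i m)) = q ^ (2 * (ix m - ix i)) *: x i m.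
Proof.
rewrite qixB mulrC -scalerA; apply: (scalerI (qix_neq0 i)).
rewrite [RHS]scalerA mulfV ?qix_neq0 // scale1r.
transitivity (\sum_l \sum_p S (S (x l m)) * (qix p *: (S (x p l) * x i p))).
  rewrite -(sum_ind i (fun l => qix l *: S (S (x l m)))); apply: eq_bigr => l _.
  rewrite -mulr_sumr sum_twisted_antipode -scalerAr mulr1 eq_sym scalerA /ind.
  by case: (eqVneq i l) => [->|_]; rewrite ?mul0r.
rewrite exchange_big -(sum_ind m (fun p => qix p *: x i p)); apply: eq_bigr => p _ /=.
have hb : bilin (fun a b : H => S a * b).
  by split=> ?; [exact: lin_mulr | exact: lin_mull].
have := sum_cop_antipode_gen p m hb.
rewrite (sum_copl_antipode hopf _ lid) (counit_antipode hopf) counit_gen => E.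
rewrite -mulr_algl E mulr_suml; apply: eq_bigr => l _.
by rewrite -!scalerAr mulrA.
Qed.

Lemma exprz_dl (r : k) i j : r ^ dl i j = r ^+ (i == j).
Proof. by []. Qed.

Lemma sigZl c a b : sig (c *: a) b = c * sig a b.
Proof. exact: (linZ (W := k^o) c a (sigl b)). Qed.

Lemma sig_gen_antipode i m j n :
  sig (x i m) (S (x j n)) = q ^ (2 * (ix i - ix m)) * Rmat q^-1 z^-1 i m j n.
Proof.
rewrite -sig_antipode3_gen antipode_sqr_gen sigZl.
by rewrite mulrA !qixB mulrA mulfVK ?qix_neq0 // mulfV ?qix_neq0 // mul1r.
Qed.

Lemma bcirc_gen i m j n :
  bcirc cop S sig (x i m) (x j n) = circ_formula q x i m j n.
Proof.
have lSS : lin (fun a => S (S a)) := lin_comp lS lS.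
rewrite /bcirc sum_sw_gen; last first.
  split=> [l|a]; last split=> [l|b]; last 1 [move=> c|]; apply: lin_sum => ly /=.
  - exact/lin_scalel/(slin_comp (sigl _))/lin_mull.
  - exact/lin_scaler/lin_mulr.
  - exact/lin_scalel/(slin_comp (sigl _))/lin_mulr.
transitivity (\sum_a \sum_p Rmat q z i a p n *: (q ^ (2 * (ix a - ix i)) *:
   \sum_b \sum_c Rmat q^-1 z^-1 b m c p *: (x a b * x j c))).
  apply: eq_bigr => a _; rewrite sum_sw_gen; last first.
    split=> [l|b] /=; first by apply: lin_sum => ly; exact/lin_scaler/lin_mulr.
    by apply: lin_sum => ly; exact/lin_scalel/(slin_comp (sigl _))/lin_mulr.
  under [RHS]eq_bigr => p _ do rewrite 2!scaler_sumr.
  rewrite [RHS]exchange_big; apply: eq_bigr => b _ /=; rewrite sum_sw0 /=.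
  rewrite sum_sw_gen; last first.
    split=> [l|c] /=; first exact/lin_scaler/lin_mull.
    exact/lin_scalel/sigr.
  under [RHS]eq_bigr => p _ do rewrite 2!scaler_sumr.
  rewrite [RHS]exchange_big; apply: eq_bigr => c _ /=; rewrite sum_sw0 /=.
  rewrite sigM_gen scaler_suml; apply: eq_bigr => p _.
  rewrite sig_antipode_gen antipode_sqr_gen sigZl.
  by rewrite sig_gen !scalerA; congr (_ *: _); ring.
rewrite Rmat_mid /= Rmat_col.
under eq_bigr => t _ do rewrite Rmat_col.
rewrite /circ_formula -/L.
have qV : q^-1 - q^-1^-1 = - L by rewrite invrK opprB.
pose G t := q ^ (2 * (ix t - ix i)) *: (x t t * x j m).
rewrite (eq_bigr (fun t => z^-1 *: (q ^ (2 * (ix t - ix i) - dl t m) *: (x t m * x j t)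
    - L *: (ind k (t < m)%N *: G t)))); last first.
  move=> t _; rewrite expfzDr // -exprz_inv exprz_dl (eq_sym t) qV -scaleNr.
  by rewrite /G !scalerDr !scalerA; congr (_ *: _ + _ *: _); ring.
rewrite -scaler_sumr sumrB -scaler_sumr.
have -> : \sum_(t < N | (i < t)%N) ind k (t < m)%N *: G t
  = \sum_(t < N | (i < t)%N && (t < m)%N) G t.
  rewrite [RHS]big_mkcondr; apply: eq_bigr => t _; rewrite /ind.
  by case: ifP => _; rewrite ?scale1r ?scale0r.
set A := x i m * x j n; set C := x i n * x j m.
have gap (l : 'I_N) : ind k (l.+1 < m)%N *: (\sum_(s < N | (l < s)%N && (s < m)%N) G s)
    = \sum_(s < N | (l < s)%N && (s < m)%N) G s.
  rewrite /ind; case: ltnP => [_|h]; first by rewrite scale1r.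
  rewrite scale0r big_pred0 // => s; apply/negbTE/negP => /andP[h1 h2].
  by have := leq_trans h2 h; rewrite ltnS leqNgt h1.
rewrite subrr mulr0 expr0z scale1r expfzDr // -exprz_inv !exprz_dl qV.
have [<-|_] := eqVneq i n.
  rewrite -(gap i) /ind mulr1n !mul1r !mulr1 !expr1 !scalerDr !scalerN !scalerA.
  rewrite -addrA -[RHS]addrA -[RHS]addrA; congr (_ *: _ + _); first by field.
  rewrite addrCA -[- ((_ * q * L) *: C)]scaleNr.
  congr (_ *: _ + (_ *: _ - _ *: _)); [by field | by field |].
  by case: (_ < m)%N; rewrite /= ?mulr1n ?mulr0n; field.
rewrite -[ind k false]/(0 : k) !mulr0 !mul0r !scale0r !subr0 !addr0 !mulr1 mul1r scale1r.
rewrite scalerA mulfV // scale1r; congr (_ + _).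
by rewrite mulrN scaleNr.
Qed.

Lemma trace_q b p : \sum_c q ^ (2 * (ix c - ix b)) * Rmat q z b c c p
  = ind k (p == b) * (z * q ^ (2 * Posz N + 1) * (qix b)^-1).
Proof.
rewrite Rmat_trace indC; under eq_bigr => c _ do rewrite qixB.
rewrite qixB -mulr_suml -(geometric_q b) /L; ring.
Qed.

Lemma trace_qV c d : \sum_b q ^ (2 * (ix c - ix b)) * Rmat q^-1 z^-1 c b b d
  = ind k (d == c) * (z^-1 * q ^ (- (2 * Posz N) - 1) * qix c).
Proof.
rewrite Rmat_trace indC.
have := geometric_ix c (invr_neq0 q0).
rewrite !exprz_inv opprD -(invr_expz q (2 * ix c)) -/(qix c) => <-.
under eq_bigr => b _ do rewrite qixB.
under [in RHS]eq_bigr => b _ do rewrite exprz_inv -invr_expz -/(qix b).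
rewrite qixB -mulr_sumr; ring.
Qed.

Lemma bS_gen i m : bS cop S sig (x i m) = S_formula q x S i m.
Proof.
have lSS : lin (fun a => S (S a)) := lin_comp lS lS.
transitivity (\sum_a \sum_b \sum_c
    sig (S (S (x b c)) * S (x i a)) (x c m) *: S (x a b)).
  have l0 b c d : lin (fun a => sig (S (S c) * S a) d *: S b).
    exact/lin_scalel/(slin_comp (sigl _))/lin_mull.
  have l2 a b d : lin (fun c => sig (S (S c) * S a) d *: S b).
    exact/lin_scalel/(slin_comp (sigl _))/lin_mulr.
  have l3 a b c : lin (fun d => sig (S (S c) * S a) d *: S b).
    exact/lin_scalel/sigr.
  have l1 a c d : lin (fun b => sig (S (S c) * S a) d *: S b).
    exact: lin_scaler.
  rewrite /bS sum_sw_gen; last first.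
    split=> [l|a]; first exact: l0.
    split=> [l|b]; first exact: l1.
    by split=> [l|c]; [exact: l2 | exact: l3].
  apply: eq_bigr => a _.
  rewrite sum_sw_gen /=; last first.
    split=> [l|b]; first exact: l1.
    by split=> [l|c]; [exact: l2 | exact: l3].
  apply: eq_bigr => b _.
  rewrite sum_sw_gen /=; last by split=> [l|c]; [exact: l2 | exact: l3].
  by apply: eq_bigr => c _; rewrite sum_sw0.
transitivity (\sum_a \sum_b Rmat q^-1 z^-1 i a b m *:
    ((z * q ^ (2 * Posz N + 1) * (qix b)^-1) *: S (x a b))).
  apply: eq_bigr => a _; apply: eq_bigr => b _.
  rewrite -scaler_suml scalerA; congr (_ *: _).
  under eq_bigr => c _ do rewrite sigM_gen.
  rewrite exchange_big /=.
  transitivity (\sum_p ind k (p == b) *: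
     (z * q ^ (2 * Posz N + 1) / qix b * Rmat q^-1 z^-1 i a p m : k^o)).
    apply: eq_bigr => p _; rewrite -[RHS]/(_ * _) mulrA -trace_q mulr_suml.
    apply: eq_bigr => c _.
    by rewrite antipode_sqr_gen sigZl sig_gen sig_antipode_gen.
  by rewrite sum_ind mulrC.
rewrite Rmat_mid /S_formula /xminus (linsum _ _ _ lS).
rewrite (eq_bigr (fun t => (z * q ^ (2 * Posz N + 1)) *:
   (q ^ (- (2 * ix t)) *: S (x t t)))); last first.
  by move=> t _; rewrite -invr_expz scalerA.
rewrite -scaler_sumr.
under [in RHS]eq_bigr => t _ do rewrite (linZ _ _ lS).
rewrite (expfzDr (- (2 * ix m))) // -[q ^ (- dl i m)]exprz_inv exprz_dl -invr_expz.
rewrite scalerDr [RHS]scalerBr -scaleNr !scalerA.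
have [->|_] := eqVneq i m.
  by congr (_ *: _ + _ *: _); rewrite /ind /qix ?invrK /= ?mulr1n; field;
    rewrite ?q0 ?z0 ?expfz_neq0.
rewrite -[ind k false]/(0 : k) !mul0r !mulr0 !mul0r !scale0r !addr0.
by congr (_ *: _); rewrite /qix /= !expr0; field; rewrite ?z0 ?expfz_neq0.
Qed.

Lemma sig_adjoint_gen i a b c d e m :
  sig (S (x i a) * x b c) (S (x c d) * x e m)
  = \sum_g \sum_e' \sum_a' \sum_h
      Rmat q z i a' g d * Rmat q^-1 z^-1 a' a e e' * Rmat q z b h e' m
      * (q ^ (2 * (ix h - ix c)) * Rmat q^-1 z^-1 h c c g).
Proof.
have hb u v : bilin (fun r t : H => sig u r * sig v t : k^o).
  by split=> ?; [exact: slin_mulr | exact: slin_mull].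
rewrite (sigM cqt); case: (hopf) => _ _ [cM _] _ _.
have := cM _ _ (hb (S (x i a)) (x b c)); rewrite /teval /= => -> {cM}.
rewrite (sum_cop_antipode_gen (W := k^o) (f := fun r t => \sum_(p' <- cop (x e m))
  sig (S (x i a)) (r * p'.1) * sig (x b c) (t * p'.2))); last first.
  split=> r; apply: (lin_sum (W := k^o)) => p'.
    exact/slin_mulr/(slin_comp (sigr _))/lin_mulr.
  exact/slin_mull/(slin_comp (sigr _))/lin_mulr.
apply: eq_bigr => g _.
rewrite (sum_cop_gen (W := k^o) (f := fun r t =>
  sig (S (x i a)) (S (x g d) * r) * sig (x b c) (S (x c g) * t))); last first.
  split=> r; first exact/slin_mulr/(slin_comp (sigr _))/lin_mull.
  exact/slin_mull/(slin_comp (sigr _))/lin_mull.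
apply: eq_bigr => e' _.
rewrite sigMr_antipode_gen sigMr_gen mulr_suml; apply: eq_bigr => a' _.
rewrite mulr_sumr; apply: eq_bigr => h _.
by rewrite sig_antipode2_gen sig_antipode_gen sig_gen_antipode sig_gen; ring.
Qed.

Lemma sum_sig_adjoint_gen i a b d e m :
  \sum_c sig (S (x i a) * x b c) (S (x c d) * x e m)
  = \sum_g \sum_e' \sum_a' z^-1 * q ^ (- (2 * Posz N) - 1) * qix g
      * (Rmat q z i a' g d * Rmat q^-1 z^-1 a' a e e' * Rmat q z b g e' m).
Proof.
under eq_bigr => c _ do rewrite sig_adjoint_gen.
rewrite exchange_big; apply: eq_bigr => g _ /=.
rewrite exchange_big; apply: eq_bigr => e' _ /=.
rewrite exchange_big; apply: eq_bigr => a' _ /=.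
rewrite exchange_big /=.
pose M h : k^o := z^-1 * q ^ (- (2 * Posz N) - 1) * qix h
      * (Rmat q z i a' g d * Rmat q^-1 z^-1 a' a e e' * Rmat q z b h e' m).
rewrite -[RHS]/(M g) -(sum_ind g M); apply: eq_bigr => h _.
by rewrite -mulr_sumr trace_qV eq_sym /M -[RHS]/(_ * _); ring.
Qed.

Lemma sum_bDelta_gen W (f : H -> H -> W) i m : bilin f ->
  teval (bDelta cop S sig (x i m)) f
  = \sum_a \sum_b \sum_c \sum_d \sum_e
      sig (S (x i a) * x b c) (S (x c d) * x e m) *: f (x a b) (x d e).
Proof.
move=> [hf1 hf2]; rewrite /teval big_map /=.
under eq_bigr => l _ do rewrite (linZ _ _ (hf1 _)).
pose F a b c d e g := sig (S a * c) (S d * g) *: f b e.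
have l0 b c d e g : lin (fun a => F a b c d e g).
  exact/lin_scalel/(slin_comp (sigl _))/lin_mulr.
have l1 a c d e g : lin (fun b => F a b c d e g) by exact/lin_scaler/hf1.
have l2 a b d e g : lin (fun c => F a b c d e g).
  exact/lin_scalel/(slin_comp (sigl _))/lin_mull.
have l3 a b c e g : lin (fun d => F a b c d e g).
  exact/lin_scalel/(slin_comp (sigr _))/lin_mulr.
have l4 a b c d g : lin (fun e => F a b c d e g) by exact/lin_scaler/hf2.
have l5 a b c d e : lin (fun g => F a b c d e g).
  exact/lin_scalel/(slin_comp (sigr _))/lin_mull.
have m1 a b c d : mlin 1 (fun l => F a b c d l`_0 l`_1).
  by split=> [l|e]; [exact: l4 | exact: l5].
have m2 a b c : mlin 2 (fun l => F a b c l`_0 l`_1 l`_2).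
  by split=> [l|d]; [exact: l3 | exact: m1].
have m3 a b : mlin 3 (fun l => F a b l`_0 l`_1 l`_2 l`_3).
  by split=> [l|c]; [exact: l2 | exact: m2].
have m4 a : mlin 4 (fun l => F a l`_0 l`_1 l`_2 l`_3 l`_4).
  by split=> [l|b]; [exact: l1 | exact: m3].
have m5 : mlin 5 (fun l => F l`_0 l`_1 l`_2 l`_3 l`_4 l`_5).
  by split=> [l|a]; [exact: l0 | exact: m4].
rewrite (sum_sw_gen _ _ m5); apply: eq_bigr => a _.
rewrite (sum_sw_gen _ _ (m4 _)); apply: eq_bigr => b _.
rewrite (sum_sw_gen _ _ (m3 _ _)); apply: eq_bigr => c _.
rewrite (sum_sw_gen _ _ (m2 _ _ _)); apply: eq_bigr => d _.
rewrite (sum_sw_gen _ _ (m1 _ _ _ _)); apply: eq_bigr => e _.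
by rewrite sum_sw0.
Qed.

(* Exchanges the sums at nesting levels [depth] and [depth.+1] of the left-hand side. *)
Ltac swap_sums depth :=
  lazymatch depth with
  | 0%N => rewrite [LHS]exchange_big /=
  | (?d.+1)%N => etransitivity; [apply: eq_bigr => ? _; swap_sums d; reflexivity |]
  end.

Lemma sum_bDelta_contract W (F : 'I_N -> 'I_N -> 'I_N -> 'I_N -> W) i m :
  \sum_a \sum_b \sum_c \sum_d \sum_e
      sig (S (x i a) * x b c) (S (x c d) * x e m) *: F a b d e
  = q ^ (- (2 * Posz N) - 1) *: (z^-1 *: \sum_g qix g *:
     (\sum_a' \sum_d Rmat q z i a' g d *:
     (\sum_b \sum_e' Rmat q z b g e' m *:
     (\sum_a \sum_e Rmat q^-1 z^-1 a' a e e' *: F a b d e)))).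
Proof.
transitivity (\sum_a \sum_b \sum_d \sum_e \sum_g \sum_e' \sum_a'
   (z^-1 * q ^ (- (2 * Posz N) - 1) * qix g
      * (Rmat q z i a' g d * Rmat q^-1 z^-1 a' a e e' * Rmat q z b g e' m))
      *: F a b d e).
  apply: eq_bigr => a _; apply: eq_bigr => b _.
  rewrite exchange_big; apply: eq_bigr => d _ /=.
  rewrite exchange_big; apply: eq_bigr => e _ /=.
  rewrite -scaler_suml sum_sig_adjoint_gen !scaler_suml.
  by apply: eq_bigr => g _; rewrite !scaler_suml; apply: eq_bigr => e' _; rewrite scaler_suml.
swap_sums 3%N; swap_sums 2%N; swap_sums 1%N; swap_sums 0%N.
swap_sums 5%N; swap_sums 4%N; swap_sums 3%N; swap_sums 2%N; swap_sums 1%N.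
swap_sums 3%N; swap_sums 2%N; swap_sums 3%N; swap_sums 5%N; swap_sums 4%N.
rewrite 2!scaler_sumr; apply: eq_bigr => g _.
rewrite 3!scaler_sumr; apply: eq_bigr => a' _.
rewrite 3!scaler_sumr; apply: eq_bigr => d _.
rewrite 4!scaler_sumr; apply: eq_bigr => b _.
rewrite 4!scaler_sumr; apply: eq_bigr => e' _.
rewrite 5!scaler_sumr; apply: eq_bigr => a _.
rewrite 5!scaler_sumr; apply: eq_bigr => e _.
by rewrite !scalerA; congr (_ *: _); ring.
Qed.

Lemma bDelta_gen i m W (f : H -> H -> W) : bilin f ->
  teval (bDelta cop S sig (x i m)) f = delta_formula q x f i m.
Proof.
move=> hf; rewrite sum_bDelta_gen //.
rewrite (sum_bDelta_contract (fun a b d e => f (x a b) (x d e))).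
rewrite /delta_formula -/L; congr (_ *: _).
under eq_bigr => g _.
  rewrite Rmat_row 2!Rmat_col 4!Rmat_mid invrK.
  over.
have [hf1 hf2] := hf.
rewrite !(scalerDr, scalerN) [RHS](AC (1*3*3*1) ((1*3*(2*6))*(4*7*(5*8)))) /=.
transitivity (
  (\sum_g (qix g * q ^+ (i == g) * q ^+ (g == m) * q^-1 ^+ (i == m)) *: f (x i g) (x g m)
 + \sum_g (- (qix g * q ^+ (i == g) * q ^+ (g == m) * ind k (i == m) * L)) *:
      \sum_(t < N | (i < t)%N) f (x t g) (x g t)
 + (\sum_g (qix g * (q ^+ (i == g) * q^-1 ^+ (i == g)) * ind k (m < g)%N * L) *:
      f (x i m) (x g g)
 + \sum_g (- (qix g * q ^+ (i == g) * ind k (m < g)%N * ind k (i == g) * L ^+ 2)) *: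
      \sum_(t < N | (i < t)%N) f (x t m) (x g t)))
 + (\sum_g (qix g * (q ^+ (g == m) * q^-1 ^+ (g == m)) * ind k (i < g)%N * L) *:
      f (x g g) (x i m)
 + \sum_g (- (qix g * q ^+ (g == m) * ind k (i < g)%N * ind k (g == m) * L ^+ 2)) *:
      \sum_(t < N | (g < t)%N) f (x t g) (x i t)
 + (\sum_g (qix g * q^-1 * ind k (i < g)%N * ind k (m < g)%N * L ^+ 2) *:
      f (x g m) (x i g)
 + \sum_g (- (qix g * ind k (i < g)%N * ind k (m < g)%N * L ^+ 3)) *:
      \sum_(t < N | (g < t)%N) f (x t m) (x i t)))).
  rewrite -!big_split /= scaler_sumr; apply: eq_bigr => g _.
  rewrite !eqxx -[ind k true]/(1 : k) !scalerDr !scalerA.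
  congr ((_ *: _ + _ *: _ + (_ *: _ + _ *: _)) + (_ *: _ + _ *: _ + (_ *: _ + _ *: _)));
    by rewrite /L; field; rewrite ?q0 ?z0.
have qVb (b : bool) : q ^+ b * q^-1 ^+ b = 1 by rewrite -exprMn mulfV // expr1n.
congr ((_ + _ + (_ + _)) + (_ + _ + (_ + _))).
- rewrite scaler_sumr; apply: eq_bigr => s _.
  rewrite scalerA !expfzDr // -exprz_inv !exprz_dl (eq_sym i s) -/(qix s).
  by congr (_ *: _); ring.
- rewrite -[RHS]scaleNr scalerA scaler_sumr; apply: eq_bigr => s _.
  rewrite -scaler_sumr scalerA.
  have [->|_] := eqVneq i m; last by rewrite /ind !mulr0 !mul0r oppr0.
  have -> : q ^ (2 * (ix s + dl s m)) = qix s * q ^+ (m == s) ^+ 2.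
    by rewrite mulrDr expfzDr // -/(qix s) [2 * dl _ _]mulrC -exprz_exp exprz_dl eq_sym.
  by rewrite (eq_sym s); congr (_ *: _); rewrite /ind; ring.
- rewrite (linsum _ _ _ (hf2 _)) -(sum_ind_cond _ (fun s => f (x i m) (q ^ (2 * ix s) *: x s s))).
  rewrite scaler_sumr; apply: eq_bigr => s _.
  by rewrite qVb (linZ _ _ (hf2 _)) !scalerA; congr (_ *: _); rewrite /qix; ring.
- transitivity (\sum_g ind k (g == i) *: (- (L ^+ 2 *: ((ind k (m < i)%N * q ^ (2 * ix i + 1)) *:
    \sum_(t < N | (i < t)%N) f (x t m) (x g t))))); last by rewrite sum_ind.
  apply: eq_bigr => g _; rewrite -scaleNr !scalerA; congr (_ *: _).
  rewrite /ind eq_sym; case: eqVneq => [->|_]; last by rewrite mulr0 !mul0r oppr0.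
  by rewrite expfzDr // expr1z -/(qix i); ring.
- rewrite (linsum _ _ _ (hf1 _)) -(sum_ind_cond _ (fun s => f (q ^ (2 * ix s) *: x s s) (x i m))).
  rewrite scaler_sumr; apply: eq_bigr => s _.
  by rewrite qVb (linZ _ _ (hf1 _)) !scalerA; congr (_ *: _); rewrite /qix; ring.
- transitivity (\sum_g ind k (g == m) *: (- (L ^+ 2 *: ((ind k (i < m)%N * q ^ (2 * ix m + 1)) *:
    \sum_(t < N | (g < t)%N) f (x t g) (x i t))))); last by rewrite sum_ind.
  apply: eq_bigr => g _; rewrite -scaleNr !scalerA; congr (_ *: _).
  rewrite /ind; case: eqVneq => [->|_]; last by rewrite mulr0 !mul0r oppr0.
  by rewrite expfzDr // expr1z -/(qix m); ring.
- rewrite -(sum_ind_cond _ (fun s => q ^ (2 * ix s - 1) *: f (x s m) (x i s))).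
  rewrite scaler_sumr; apply: eq_bigr => s _; rewrite !scalerA; congr (_ *: _).
  rewrite expfzDr // -/(qix s) exprN1 /ind.
  by case: (i < s)%N; case: (m < s)%N => /=; rewrite ?mulr0n ?mulr1n; ring.
- under [in RHS]eq_bigr => s _ do rewrite -scaler_sumr.
  rewrite -(sum_ind_cond _ (fun s => q ^ (2 * ix s) *: \sum_(t < N | (s < t)%N) f (x t m) (x i t))).
  rewrite scaler_sumr -sumrN; apply: eq_bigr => s _; rewrite -scaleNr !scalerA.
  congr (_ *: _); rewrite -/(qix s) /ind.
  by case: (i < s)%N; case: (m < s)%N => /=; rewrite ?mulr0n ?mulr1n; ring.
Qed.

End Generators.

Theorem theorem6p15 (k : fieldType) (q z : k) (N : nat) (H : algType k)
    (x : 'I_N -> 'I_N -> H) (cop : H -> seq (H * H)) (eps : H -> k)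
    (S : H -> H) (sig : H -> H -> k) :
  (2 <= N)%N -> q != 0 -> q ^+ 2 != 1 -> z ^+ N = q^-1 ->
  SLq_presentation q x ->
  is_hopf cop eps S ->
  SLq_coalg_gens cop eps x ->
  is_cqt cop eps sig ->
  sigma_gens q z x sig ->
  [/\ (* unit of (H, o) is the unit 1 of SL_q(N) *)
      (forall y : H, bcirc cop S sig 1 y = y /\ bcirc cop S sig y 1 = y),
      (* counit of underline Delta is the counit eps of SL_q(N) *)
      (forall y : H, \sum_(p <- bDelta cop S sig y) eps p.1 *: p.2 = y /\
                     \sum_(p <- bDelta cop S sig y) eps p.2 *: p.1 = y),
      (forall i m j n : 'I_N,
         bcirc cop S sig (x i m) (x j n) = circ_formula q x i m j n),
      (forall (i m : 'I_N) (W : lmodType k) (f : H -> H -> W), bilin f ->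
         teval (bDelta cop S sig (x i m)) f = delta_formula q x f i m)
    & (forall i m : 'I_N, bS cop S sig (x i m) = S_formula q x S i m)].
Proof.
move=> N2 q0 _ zN _ hopf gens cqt sgens.
have z0 : z != 0.
  apply: contraNneq q0 => z0.
  by rewrite -invr_eq0 -zN z0 expr0n gtn_eqF ?eqxx // ltnW.
split.
- exact: (bcirc_unit hopf cqt).
- exact: (bDelta_counit hopf cqt).
- exact: (bcirc_gen q0 z0 hopf gens cqt sgens).
- move=> i m W f; exact: (bDelta_gen q0 z0 hopf gens cqt sgens).
- exact: (bS_gen q0 z0 hopf gens cqt sgens).
Qed.
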